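(* Let $B_4$ be the Bruhat graph of order $4$ (the 4th weak Bruhat graph, on 24 vertices). Then $\pi(B_4)\le 66$, where $\pi$ denotes the pebbling number.
   Context: A configuration of pebbles on a simple connected undirected graph $G=(V,E)$ is a function $C:V\to\mathbb{Z}_{\ge 0}$; its size is $|C|=\sum_{v\in V}C(v)$. A pebbling move from $u$ to $v$ along an edge $\{u,v\}\in E$ removes two pebbles from $u$ (which must have at least two) and places one pebble on $v$. A pebble can be moved to a vertex $r$ from $C$ if some finite (possibly empty) sequence of pebbling moves starting at $C$ results in a configuration with at least one pebble on $r$; in that case $C$ is called $r$-solvable. The rooted pebbling number $\pi(G,r)$ is the smallest integer $k$ such that every configuration of size $k$ is $r$-solvable. The pebbling number $\pi(G)$ is the smallest integer $k$ such that every configuration of size $k$ is $r$-solvable for every $r\in V$. The graph $B_4$ has vertex set $\{v_1,\dots,v_{24}\}$ and the following 36 edges, where $i$–$j$ denotes the edge $\{v_i,v_j\}$: 1–2, 2–4, 4–3, 3–1, 3–21, 4–24, 2–8, 1–5, 5–6, 6–7, 7–8, 8–12, 12–20, 20–24, 24–23, 23–22, 22–21, 21–17, 17–9, 9–5, 9–10, 6–10, 10–13, 7–11, 11–12, 23–19, 19–20, 18–17, 22–18, 18–15, 19–16, 11–14, 13–15, 13–14, 14–16, 16–15. *)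

(* Defs.v *)
From Stdlib Require Import Relation_Operators.
From mathcomp Require Import all_boot.

Set Implicit Arguments.
Unset Strict Implicit.
Unset Printing Implicit Defensive.

Record sgraph := SGraph {
  vertex :> finType;
  adj : rel vertex;
  adj_sym : symmetric adj;
  adj_irrefl : irreflexive adj;
  adj_connected : forall u v : vertex, connect adj u v
}.

Section Pebbling.

Variable G : sgraph.

Definition configuration := {ffun G -> nat}.

Definition config_size (C : configuration) : nat := \sum_(v : G) C v.

(* u != v whenever adj u v, so the two updates never act on the same vertex,
   and 1 < C u means that the subtraction does not truncate. *)
Definition pebbling_move (C D : configuration) : Prop :=
  exists u v : G,
    [/\ adj u v, 1 < C u
      & D = [ffun w => if w == u then C w - 2
                       else if w == v then C w + 1 else C w]].

Definition solvable (r : G) (C : configuration) : Prop :=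
  exists2 D : configuration,
    clos_refl_trans configuration pebbling_move C D & 0 < D r.

Definition all_solvable (k : nat) : Prop :=
  forall C : configuration, config_size C = k -> forall r : G, solvable r C.

(* A relation rather than a function; k is unique by antisymmetry of <=. *)
Definition is_pebbling_number (k : nat) : Prop :=
  all_solvable k /\ (forall m : nat, all_solvable m -> k <= m).

End Pebbling.

Definition B4_edges : seq (nat * nat) :=
  [:: (1, 2); (2, 4); (4, 3); (3, 1); (3, 21); (4, 24); (2, 8); (1, 5);
      (5, 6); (6, 7); (7, 8); (8, 12); (12, 20); (20, 24); (24, 23); (23, 22);
      (22, 21); (21, 17); (17, 9); (9, 5); (9, 10); (6, 10); (10, 13); (7, 11);
      (11, 12); (23, 19); (19, 20); (18, 17); (22, 18); (18, 15); (19, 16);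
      (11, 14); (13, 15); (13, 14); (14, 16); (16, 15)].

(* The vertex v_i is the ordinal i - 1. *)
Definition B4_adj : rel 'I_24 := fun x y =>
  ((x.+1, y.+1) \in B4_edges) || ((y.+1, x.+1) \in B4_edges).

Lemma B4_adj_sym : symmetric B4_adj.
Proof. by move=> x y; rewrite /B4_adj orbC. Qed.

Lemma B4_adj_irrefl : irreflexive B4_adj.
Proof. by case=> m lt_m; move: lt_m; do 24!case: m => [|m] //. Qed.

(* Parents, by label minus one, in a spanning tree of B_4 rooted at v_1. *)
Definition B4_parent (m : nat) : nat :=
  nth 0 [:: 0; 0; 0; 1; 0; 4; 5; 1; 4; 5; 6; 7; 9; 10; 12; 13; 8; 16; 19; 11;
            2; 20; 23; 3] m.

Lemma B4_parentP (m : nat) : m < 24 ->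
  [&& B4_parent m < 24, iter 24 B4_parent m == 0 &
      [|| m == 0, ((B4_parent m).+1, m.+1) \in B4_edges
        | (m.+1, (B4_parent m).+1) \in B4_edges]].
Proof. by do 24!case: m => [|m] //. Qed.

Lemma B4_connected (x y : 'I_24) : connect B4_adj x y.
Proof.
suff root z : connect B4_adj z ord0.
  apply: connect_trans (root x) _.
  by rewrite (sym_connect_sym B4_adj_sym); apply: root.
have /and3P[_ /eqP it0 _] := B4_parentP (ltn_ord z).
move: it0; generalize 24 at 1 => n; elim: n z => [|n IHn] z it0.
  by have -> : z = ord0 by apply: val_inj.
have /and3P[lt_p _ /or3P par] := B4_parentP (ltn_ord z).
have [/eqP z0 | z_neq0] := boolP (val z == 0).
  by have -> : z = ord0 by apply: val_inj.
apply: connect_trans (IHn (Ordinal lt_p) _); last by rewrite /= -iterSr.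
apply: connect1; rewrite /B4_adj /=; case: par => [/eqP z0|->|->] //.
- by case/eqP: z_neq0.
- exact: orbT.
Qed.

Definition B4 : sgraph := SGraph B4_adj_sym B4_adj_irrefl B4_connected.

(* Main.v *)
Require Import Defs.
From Stdlib Require Import Relation_Operators Classical.
From mathcomp Require Import all_boot zify.

(** The bound comes from the weight function method.  Let [T] be a tree in [G]
containing the root [r], with a weight on each vertex other than [r], such that
the weight of every parent other than [r] is at least twice the weight of each
of its children.  If [r] cannot be reached from [C], then the weight of [C] on
[T] is at most the weight of the configuration with one pebble on each vertex
of [T] other than [r] ([weight_lemma]): pushing pebbles from the leaves towards
[r] never loses weight except for the at most one pebble that stays behind on
each vertex.  If several such trees together give every vertex other than [r]
weight at least [N], and their weights add up to less than [N * k], then every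
configuration of size [k] is [r]-solvable ([weight_certificate]).

The graph [B4] is the Cayley graph of the symmetric group on four letters for
the three adjacent transpositions.  A word in these generators, read as a walk
starting at [r], names a vertex relative to [r]; a tree is therefore a list of
words, the parent of a word being the word without its last letter, and one list
of trees serves for all 24 roots.  Every tree used below contains a walk from
[r] to its antipode, at distance 6, and a word of length [l] has weight
[2 ^ (6 - l)].  The eight trees [B4_trees] give each vertex other than [r]
weight at least 8, and have total weight [520 = 8 * 65], whence the bound 66. *)

Set Implicit Arguments.
Unset Strict Implicit.
Unset Printing Implicit Defensive.

(** * Weight functions on trees *)

Section WeightFunctions.

Variable G : sgraph.

Implicit Types (C D : configuration G) (r u v : G).

Lemma solvable_move r C D : pebbling_move C D -> solvable r D -> solvable r C.
Proof.
move=> mvCD [D' mvDD' D'r]; exists D' => //.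
exact: rt_trans (rt_step _ _ _ _ mvCD) mvDD'.
Qed.

Lemma solvable_occupied r C : 0 < C r -> solvable r C.
Proof. by exists C => //; apply: rt_refl. Qed.

(** The configuration obtained from [C] by [m] moves from [u] to [v]. *)
Definition push C u v (m : nat) : configuration G :=
  [ffun w => if w == u then C w - m.*2 else if w == v then C w + m else C w].

Lemma solvable_push r C u v m :
  adj u v -> m.*2 <= C u -> solvable r (push C u v m) -> solvable r C.
Proof.
move=> uv; elim: m C => [|m IHm] C le_mC.
  suff -> : push C u v 0 = C by [].
  by apply/ffunP => w; rewrite ffunE subn0 addn0 !if_same.
have u_neq_v : (v == u) = false.
  by apply/eqP => vu; move: uv; rewrite vu adj_irrefl.
set C1 := push C u v 1.
have C1u : C1 u = C u - 2 by rewrite ffunE eqxx.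
have -> : push C u v m.+1 = push C1 u v m.
  apply/ffunP => w; rewrite !ffunE; case: eqP => _; first by lia.
  by case: eqP => _ //; lia.
move=> solC; apply: (@solvable_move _ _ C1); last first.
  by apply: IHm solC; rewrite C1u; lia.
by exists u, v; split=> //; lia.
Qed.

(** A weighted tree is a list of triples (vertex, parent, weight). *)
Definition weighted_tree := seq (G * G * nat).

Implicit Types (T : weighted_tree) (S : seq weighted_tree).

Definition tree_weight T v : nat := sumn [seq e.2 | e <- T & e.1.1 == v].

Definition total_weight T : nat := sumn [seq e.2 | e <- T].

Definition config_weight T C : nat := \sum_(e <- T) e.2 * C e.1.1.

(** [T] is a tree rooted at [r], listed with children before parents, in which
weights at least double from a vertex to its parent, unless the parent is
[r].  A vertex whose parent is neither [r] nor listed later must have weight 0,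
and contributes nothing. *)
Fixpoint weight_strategy r T : bool :=
  if T is (v, p, w) :: T' then
    [&& adj v p, v \notin [seq e.1.1 | e <- T'],
        (p == r) || (w.*2 <= tree_weight T' p) & weight_strategy r T']
  else true.

Lemma config_weightE T C :
  config_weight T C = \sum_v tree_weight T v * C v.
Proof.
rewrite /config_weight /tree_weight; elim: T => [|e T IHT] /=.
  by rewrite big_nil big1.
rewrite big_cons IHT (bigD1 e.1.1) //= [RHS](bigD1 e.1.1) //= eqxx /= mulnDl.
rewrite addnA; congr (_ + _); apply: eq_bigr => v /negPf.
by rewrite eq_sym => ->.
Qed.

Lemma tree_weight_notin T v :
  v \notin [seq e.1.1 | e <- T] -> tree_weight T v = 0.
Proof.
rewrite /tree_weight; elim: T => //= e T IHT.
by rewrite inE negb_or eq_sym => /andP[/negPf-> /IHT].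
Qed.

Lemma config_weight_push T C u v m :
    u != v -> u \notin [seq e.1.1 | e <- T] ->
  config_weight T (push C u v m) = config_weight T C + m * tree_weight T v.
Proof.
move=> u_neq_v uT; rewrite !config_weightE (bigD1 v) //= [in RHS](bigD1 v) //=.
rewrite ffunE eq_sym (negPf u_neq_v) eqxx mulnDr addnAC [_ * m]mulnC.
congr (_ + _ + _); apply: eq_bigr => w w_neq_v; rewrite ffunE (negPf w_neq_v).
by case: eqP => // ->; rewrite (tree_weight_notin uT).
Qed.

Lemma weight_lemma r T C :
    weight_strategy r T -> total_weight T < config_weight T C ->
  solvable r C.
Proof.
rewrite /total_weight; elim: T C => [|[[v p] w] T IHT] C /=.
  by rewrite /config_weight big_nil.
case/and4P=> vp vT wp strT lt_wC; have [C_small | C_big] := boolP (C v <= 1).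
  apply: IHT strT _; move: lt_wC; rewrite /config_weight big_cons /=.
  by have := leq_mul (leqnn w) C_small; lia.
have v_neq_p : v != p by apply/eqP => eq_vp; move: vp; rewrite eq_vp adj_irrefl.
have le_half : (C v)./2.*2 <= C v.
  by rewrite -[leqRHS]odd_double_half leq_addl.
apply: (solvable_push vp le_half).
have [p_r | p_neq_r] := eqVneq p r.
  apply: solvable_occupied; rewrite -p_r ffunE eq_sym (negPf v_neq_p) eqxx.
  by rewrite addn_gt0 half_gt0 [1 < _]ltnNge C_big orbT.
apply: IHT strT _; rewrite (config_weight_push _ _ v_neq_p vT).
move: wp lt_wC; rewrite (negPf p_neq_r) /= => wp.
rewrite /config_weight big_cons /= -{1}[C v]odd_double_half mulnDr.
(* The weight lost is that of the pebble left on [v] if [C v] is odd. *)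
have := leq_mul (leqnn (C v)./2) wp.
by case: (odd (C v)); rewrite -!mul2n; lia.
Qed.

Lemma weight_certificate r S N k C :
    all (weight_strategy r) S ->
    (forall v, v != r -> N <= sumn [seq tree_weight T v | T <- S]) ->
    sumn [seq total_weight T | T <- S] < N * k ->
  config_size C = k -> solvable r C.
Proof.
move=> strS coverS totS sizeC.
have [Cr | ] := posnP (C r); last exact: solvable_occupied.
have [/hasP[T TS ltT] | /hasPn noT] :=
    boolP (has (fun T => total_weight T < config_weight T C) S).
  exact: weight_lemma (allP strS _ TS) ltT.
case/negP: (negbT (ltnn (N * k))); apply: leq_ltn_trans totS.
rewrite -[in leqLHS]sizeC /config_size big_distrr sumnE big_map /=.
apply: (@leq_trans (\sum_(T <- S) config_weight T C)); last first.
  rewrite big_seq [leqRHS]big_seq; apply: leq_sum => T /noT.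
  by rewrite -leqNgt.
rewrite (eq_bigr _ (fun T _ => config_weightE T C)).
rewrite exchange_big; apply: leq_sum => v _; rewrite -big_distrl /=.
have [-> | /coverS] := eqVneq v r; first by rewrite Cr muln0.
by rewrite sumnE big_map leq_mul2r => ->; rewrite orbT.
Qed.

End WeightFunctions.

Lemma exists_pebbling_number (G : sgraph) (k : nat) :
  all_solvable G k -> exists2 m, is_pebbling_number G m & m <= k.
Proof.
elim/ltn_ind: k => k IHk solk.
have [[m [lt_mk solm]] | minimal] :=
    classic (exists m, m < k /\ all_solvable G m).
  have [n pn le_nm] := IHk m lt_mk solm.
  by exists n => //; apply: leq_trans le_nm (ltnW lt_mk).
exists k => //; split=> // m solm; rewrite leqNgt; apply/negP => lt_mk.
by apply: minimal; exists m.
Qed.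

(** * The certificate for the Bruhat graph of order 4 *)

(** The ordinal [i] as a vertex of [B4], for [i < 24]; the remainder makes the
function total and lets it compute. *)
Definition B4_vertex (i : nat) : B4 := Ordinal (ltn_pmod i (isT : 0 < 24)).

Lemma B4_vertexE (v : B4) : v = B4_vertex v.
Proof. by apply: val_inj; rewrite /= modn_small. Qed.

(** Right multiplication by the adjacent transposition number [a] in [1, 2, 3],
on labels minus one: a proper edge colouring of [B4].  The transpositions 1 and
3 commute, and the 4-cycles of [B4] are their cosets; the edges in no 4-cycle
carry the colour 2. *)
Definition B4_step (i a : nat) : nat :=
  nth 0 (nth [::]
    [:: [:: 1; 0; 3; 2; 5; 4; 7; 6; 9; 8; 11; 10; 14; 15; 12; 13; 17; 16; 19;
            18; 21; 20; 23; 22];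
        [:: 4; 7; 20; 23; 0; 6; 5; 1; 16; 12; 13; 19; 9; 10; 17; 18; 8; 14; 15;
            11; 2; 22; 21; 3];
        [:: 2; 3; 0; 1; 8; 9; 10; 11; 4; 5; 6; 7; 13; 12; 15; 14; 20; 21; 22;
            23; 16; 17; 18; 19]] a.-1) i.

(** The end of the walk from [i] along the colours of a word. *)
Definition B4_walk (i : nat) (word : seq nat) : nat := foldl B4_step i word.

(** The tree of words [t] placed at the root [i]. *)
Definition B4_tree_at (i : nat) (t : seq (seq nat)) : weighted_tree B4 :=
  [seq (B4_vertex (B4_walk i word),
        B4_vertex (B4_walk i (take (size word).-1 word)),
        2 ^ (6 - size word)) | word <- t].

(** The longest words are reduced words for the longest element of the group.
The trees come from an optimal solution of the linear program that minimizes
total weight, in which the repeated tree has coefficient 2. *)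
Definition B4_trees : seq (seq (seq nat)) :=
  let t2 := [:: [:: 2; 1; 3; 2; 1; 3]; [:: 2; 1; 3; 2; 1]; [:: 2; 1; 3; 2; 3];
                [:: 2; 1; 3; 2]; [:: 2; 1; 3]; [:: 2; 1]; [:: 2]] in
  [:: [:: [:: 1; 2; 3; 2; 1; 2]; [:: 1; 2; 3; 1; 2]; [:: 1; 2; 3; 2; 1];
          [:: 1; 2; 3; 1]; [:: 1; 2; 3; 2]; [:: 1; 2; 3]; [:: 1; 2]; [:: 1]];
      t2;
      t2;
      [:: [:: 2; 3; 2; 1; 2; 3]; [:: 2; 3; 2; 1; 2]; [:: 2; 3; 2; 1];
          [:: 2; 3; 2]; [:: 2; 3]; [:: 2]];
      [:: [:: 3; 1; 2; 1; 3; 2]; [:: 3; 1; 2; 1; 3]; [:: 3; 1; 2; 1];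
          [:: 3; 1; 2]; [:: 3; 1]; [:: 3]];
      [:: [:: 3; 1; 2; 3; 1; 2]; [:: 3; 1; 2; 3; 1]; [:: 3; 1; 2; 3];
          [:: 3; 1; 2]; [:: 3; 1]; [:: 3]];
      [:: [:: 2; 1; 2; 3; 2; 1]; [:: 2; 1; 2; 3; 2]; [:: 2; 1; 2; 3];
          [:: 2; 1; 2]; [:: 2; 1]; [:: 2]];
      [:: [:: 3; 2; 1; 2; 3; 2]; [:: 3; 2; 1; 2; 3]; [:: 3; 2; 1; 3; 2];
          [:: 3; 2; 1; 2]; [:: 3; 2; 1; 3]; [:: 3; 2; 1]; [:: 3; 2]; [:: 3]]].

Definition B4_trees_at (i : nat) : seq (weighted_tree B4) :=
  [seq B4_tree_at i t | t <- B4_trees].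

Lemma B4_trees_strategy :
  all (fun i => all (weight_strategy (B4_vertex i)) (B4_trees_at i))
      (iota 0 24).
Proof. by vm_compute. Qed.

Lemma B4_trees_cover :
  all (fun i => all (fun j => (j == i) ||
         (8 <= sumn [seq tree_weight T (B4_vertex j) | T <- B4_trees_at i]))
       (iota 0 24)) (iota 0 24).
Proof. by vm_compute. Qed.

Lemma B4_trees_total (i : nat) :
  sumn [seq total_weight T | T <- B4_trees_at i] = 520.
Proof. by []. Qed.

Lemma B4_all_solvable : all_solvable B4 66.
Proof.
move=> C sizeC r.
have v_in (v : B4) : (v : nat) \in iota 0 24 by rewrite mem_iota ltn_ord.
apply: (@weight_certificate _ r (B4_trees_at r) 8 66) sizeC => [|v v_neq_r|].
- by rewrite {1}(B4_vertexE r); apply: (allP B4_trees_strategy _ (v_in r)).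
- have /allP/(_ _ (v_in v)) := allP B4_trees_cover _ (v_in r).
  by rewrite -B4_vertexE (inj_eq val_inj) (negPf v_neq_r).
- by rewrite B4_trees_total.
Qed.

Theorem theorem4p1 : exists2 k : nat, is_pebbling_number B4 k & k <= 66.
Proof. exact: exists_pebbling_number B4_all_solvable. Qed.
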